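(* Let $(\mathfrak{A},\varphi,T)$ be a state preserving $C^*$-dynamical system. The following conditions are equivalent: (i) $(\mathfrak{A},\varphi,T)$ is strictly ergodic; (ii) for every $x\in\mathfrak{A}$, $$\lim_{n\to\infty}\frac{1}{n}\sum_{k=0}^{n-1}T^k(x)=\varphi(x)\mathbf{1},$$ where the convergence is in the norm of $\mathfrak{A}$; (iii) for every $x\in\mathfrak{A}$ and every state $\psi$ on $\mathfrak{A}$, $$\lim_{n\to\infty}\frac{1}{n}\sum_{k=0}^{n-1}\psi(T^k(x))=\varphi(x).$$
   Context: $\mathfrak{A}$ denotes a (complex) $C^*$-algebra with unit $\mathbf{1}$. A state on $\mathfrak{A}$ is a positive linear functional taking the value $1$ at $\mathbf{1}$. A Markov operator is a positive linear map $T:\mathfrak{A}\to\mathfrak{A}$ with $T\mathbf{1}=\mathbf{1}$. A state preserving $C^*$-dynamical system is a triple $(\mathfrak{A},\varphi,T)$ where $\varphi$ is a state on $\mathfrak{A}$ and $T:\mathfrak{A}\to\mathfrak{A}$ is a Markov operator with $\varphi\circ T=\varphi$. It is called strictly ergodic if $\varphi$ is the unique state $\psi$ on $\mathfrak{A}$ with $\psi\circ T=\psi$. *)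

(* Defs.v *)
From HB Require Import structures.
From mathcomp Require Import all_boot all_order all_algebra.
From mathcomp Require Import complex.
From mathcomp Require Import all_classical all_reals topology normedtype.

Set Implicit Arguments.
Unset Strict Implicit.
Unset Printing Implicit Defensive.

Import Order.TTheory GRing.Theory Num.Theory.
Import numFieldNormedType.Exports.

Local Open Scope classical_set_scope.
Local Open Scope ring_scope.
Local Open Scope complex_scope.

(* Unital complex C*-algebras, over a complex Banach space.  The ring
   operations are part of the mixin because Hierarchy Builder rejects a common
   substructure of GRing.NzRing and Num.NormedZmodule that is not below
   Num.NumDomain.  Norms take values in R[i], where 0 <= z means that z is real
   and nonnegative. *)
HB.mixin Record isCstarAlgebra (R : realType) A
    of CompleteNormedModule R[i] A := {
  cunit : A;
  cmul : A -> A -> A;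
  cstar : A -> A;
  cmulA : associative cmul;
  cmul1l : left_id cunit cmul;
  cmul1r : right_id cunit cmul;
  cmulDl : left_distributive cmul +%R;
  cmulDr : right_distributive cmul +%R;
  cscaleAl : forall (c : R[i]) (x y : A), c *: cmul x y = cmul (c *: x) y;
  cscaleAr : forall (c : R[i]) (x y : A), c *: cmul x y = cmul x (c *: y);
  cstarD : {morph cstar : x y / x + y};
  cstarZ : forall (c : R[i]) (x : A), cstar (c *: x) = c^* *: cstar x;
  cstarM : forall x y : A, cstar (cmul x y) = cmul (cstar y) (cstar x);
  cstarK : involutive cstar;
  cnormM : forall x y : A, `|cmul x y| <= `|x| * `|y|;
  cnorm_star : forall x : A, `|cmul (cstar x) x| = `|x| ^+ 2
}.

#[short(type="cstarAlgType")]
HB.structure Definition CstarAlgebra (R : realType) :=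
  {A of CompleteNormedModule R[i] A & isCstarAlgebra R A}.

Arguments cunit {R s}.

Section Dynamics.
Variables (R : realType) (A : cstarAlgType R).
Implicit Types (phi psi : {scalar A}) (T : {linear A -> A}).

Definition positive (x : A) : Prop := exists y : A, x = cmul (cstar y) y.

Definition is_state phi : Prop :=
  (forall x, positive x -> 0 <= phi x) /\ phi cunit = 1.

Definition is_markov T : Prop :=
  (forall x, positive x -> positive (T x)) /\ T cunit = cunit.

Definition preserves T phi : Prop := forall x, phi (T x) = phi x.

Definition state_preserving_system phi T : Prop :=
  [/\ is_state phi, is_markov T & preserves T phi].

Definition strictly_ergodic phi T : Prop :=
  [/\ is_state phi, preserves T phi
    & forall psi, is_state psi -> preserves T psi -> psi =1 phi].

End Dynamics.

(* Main.v *)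
(* (i) => (ii).  For self-adjoint x let p(x) be the limit superior, with respect
   to the order unit 1, of the averages S_n x: the infimum of the r such that
   r 1 - S_n x >= 0 for all large n.  It is sublinear, nonpositive on
   coboundaries T y - y and on negative elements, and p(r 1) = r, so a linear
   functional dominated by p is a T-invariant state.  By Hahn-Banach there is one
   with value p(x) at x; unique ergodicity gives p(x) = phi(x), and p(-x) =
   - phi(x) likewise, so S_n x tends to phi(x) 1 in the order-unit sense, hence
   in norm.

   The last step needs that the elements y^* y form a closed proper cone whose
   order controls the norm.  This is obtained without spectral theory from the
   norm description of positivity, |r 1 - x| <= r for some r, and from square
   roots built as limits of the iteration y -> (x + y^2) / 2. *)

Require Import Defs.
From HB Require Import structures.
From mathcomp Require Import all_boot all_order all_algebra.
From mathcomp Require Import complex.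
From mathcomp Require Import all_classical all_reals topology normedtype.
From mathcomp Require Import ring lra.

Set Implicit Arguments.
Unset Strict Implicit.
Unset Printing Implicit Defensive.

Import Order.TTheory GRing.Theory Num.Theory.
Import numFieldNormedType.Exports.

Local Open Scope classical_set_scope.
Local Open Scope ring_scope.

(* The algebra seen over the reals, so that it can carry ring and R-module
   structures: see Defs for why A itself has no ring structure. *)
Definition realified (R : realType) (A : cstarAlgType R) : Type := A.

(** * The algebra over the reals and its real-valued norm *)

Section RealAlgebra.
Local Open Scope complex_scope.
Variables (R : realType) (A : cstarAlgType R).
Local Notation B := (realified A).
Implicit Types (x y : B) (r s : R).

HB.instance Definition _ := GRing.Zmodule.on B.

HB.instance Definition _ := @GRing.Zmodule_isPzRing.Build B (cunit : A)
  (@cmul R A) (@cmulA R A) (@cmul1l R A) (@cmul1r R A) (@cmulDl R A)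
  (@cmulDr R A).

Fact realified_scaleA r s x : r%:C *: (s%:C *: (x : A)) = (r * s)%:C *: (x : A).
Proof. by rewrite scalerA -rmorphM. Qed.

Fact realified_scale1 : left_id 1 (fun r x => r%:C *: (x : A) : B).
Proof. by move=> x; rewrite scale1r. Qed.

Fact realified_scaleDr :
  right_distributive (fun r x => r%:C *: (x : A) : B) +%R.
Proof. by move=> r x y; rewrite scalerDr. Qed.

Fact realified_scaleDl x :
  {morph (fun r => r%:C *: (x : A) : B) : r s / r + s}.
Proof. by move=> r s; rewrite rmorphD scalerDl. Qed.

HB.instance Definition _ := @GRing.Zmodule_isLmodule.Build R B
  _ realified_scaleA realified_scale1 realified_scaleDr realified_scaleDl.

Lemma scale_realified r x : r *: x = r%:C *: (x : A).
Proof. by []. Qed.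

Lemma scale_mull r x y : r *: (x * y) = (r *: x) * y.
Proof. exact: cscaleAl. Qed.

Lemma scale_mulr r x y : r *: (x * y) = x * (r *: y).
Proof. exact: cscaleAr. Qed.

Lemma conj_complexE (c : R[i]) : Num.conj c = conjc c.
Proof. by []. Qed.

Definition star x : B := cstar (x : A).
(** Only real scalars act on [realified A]; multiplication by i survives as this real-linear map. *)
Definition muli x : B := 'i%C *: (x : A).
(** Norms on [A] are nonnegative elements of [R[i]], hence real, so taking the real part loses
    nothing. *)
Definition nrm x : R := complex.Re `|x : A|.

Lemma starD x y : star (x + y) = star x + star y.
Proof. exact: cstarD. Qed.

Lemma starM x y : star (x * y) = star y * star x.
Proof. exact: cstarM. Qed.

Lemma starK x : star (star x) = x.
Proof. exact: cstarK. Qed.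

Lemma starZ r x : star (r *: x) = r *: star x.
Proof. by rewrite /star !scale_realified cstarZ conj_complexE conjc_real. Qed.

Lemma starN x : star (- x) = - star x.
Proof. by rewrite -scaleN1r starZ scaleN1r. Qed.

Lemma star0 : star 0 = 0.
Proof. by rewrite -[0](scale0r (1 : B)) starZ !scale0r. Qed.

Lemma star1 : star 1 = 1.
Proof. by rewrite -[LHS]mulr1 -[X in _ * X]starK -starM mulr1 starK. Qed.

Lemma muliD x y : muli (x + y) = muli x + muli y.
Proof. exact: (@scalerDr _ A 'i%C). Qed.

Lemma muliN x : muli (- x) = - muli x.
Proof. exact: (@scalerN _ A 'i%C). Qed.

Lemma muliK x : muli (muli x) = - x.
Proof. by rewrite /muli scalerA -expr2 sqr_i scaleN1r. Qed.

Lemma muliZ r x : muli (r *: x) = r *: muli x.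
Proof. by rewrite /muli !scale_realified !scalerA mulrC. Qed.

Lemma muli_mull x y : muli (x * y) = muli x * y.
Proof. exact: cscaleAl. Qed.

Lemma muli_mulr x y : muli (x * y) = x * muli y.
Proof. exact: cscaleAr. Qed.

Lemma star_muli x : star (muli x) = - muli (star x).
Proof.
rewrite /star /muli cstarZ conj_complexE (_ : conjc _ = - 'i%C) ?scaleNr//.
by apply/eqP; rewrite eq_complex /= oppr0 !eqxx.
Qed.

Lemma nrmE x : `|x : A| = (nrm x)%:C.
Proof.
rewrite /nrm; have : 0 <= `|x : A| by [].
by case: `|x : A| => a b; rewrite lecE /= => /andP[/eqP -> _].
Qed.

Lemma nrm_ge0 x : 0 <= nrm x.
Proof. by rewrite -ler0c -nrmE. Qed.

Lemma nrm0P x : nrm x <= 0 -> x = 0.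
Proof.
move=> h; have {h} e : nrm x = 0 by apply/eqP; rewrite eq_le h nrm_ge0.
by apply/eqP; rewrite -(normr_eq0 (x : A)) nrmE e.
Qed.

Lemma nrm0 : nrm 0 = 0.
Proof. by apply: complexI; rewrite -nrmE normr0. Qed.

Lemma nrmD x y : nrm (x + y) <= nrm x + nrm y.
Proof.
by have := ler_normD (x : A) y; rewrite (nrmE (x + y)) !nrmE -rmorphD lecR.
Qed.

Lemma nrmN x : nrm (- x) = nrm x.
Proof. by congr complex.Re; exact: (normrN (x : A)). Qed.

Lemma nrmB x y : nrm (x - y) <= nrm x + nrm y.
Proof. by rewrite -(nrmN y) nrmD. Qed.

Lemma nrm_dist x y : nrm (x - y) = nrm (y - x).
Proof. by rewrite -nrmN opprB. Qed.

Lemma nrmZ r x : nrm (r *: x) = `|r| * nrm x.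
Proof.
apply: complexI; rewrite rmorphM -nrmE scale_realified normrZ nrmE.
by have := normc_def r%:C; rewrite /= expr0n addr0 sqrtr_sqr => <-.
Qed.

Lemma nrm_muli x : nrm (muli x) = nrm x.
Proof.
rewrite /nrm /muli normrZ; congr complex.Re.
rewrite -[RHS]mul1r; congr (_ * _); have := normc_def ('i%C : R[i]).
by rewrite /= expr0n add0r expr1n sqrtr1.
Qed.

Lemma nrmM x y : nrm (x * y) <= nrm x * nrm y.
Proof.
by have := cnormM (x : A) y; rewrite (nrmE (x * y)) !nrmE -rmorphM lecR.
Qed.

Lemma nrm_starM x : nrm (star x * x) = nrm x ^+ 2.
Proof. apply: complexI; have := cnorm_star (x : A).
by rewrite (nrmE (star x * x)) nrmE -rmorphXn. Qed.

(** The C*-identity and submultiplicativity give [nrm y ^+ 2 <= nrm (star y) * nrm y]; cancel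
    [nrm y], then exchange [y] and [star y]. *)
Lemma nrm_star x : nrm (star x) = nrm x.
Proof.
have le y : nrm y <= nrm (star y).
  have := nrmM (star y) y; rewrite nrm_starM; have := nrm_ge0 y.
  have := nrm_ge0 (star y); nra.
by apply/eqP; rewrite eq_le le -{2}[x]starK le.
Qed.

Lemma nrm_sqr x : star x = x -> nrm (x * x) = nrm x ^+ 2.
Proof. by move=> xs; rewrite -nrm_starM xs. Qed.

(** The norm of a self-adjoint idempotent equals its own square. Equality with 1 would fail in the
    zero algebra, which the definition admits. *)
Lemma nrm1 : nrm 1 <= 1.
Proof.
have := nrm_sqr star1; rewrite mulr1; have := nrm_ge0 1; nra.
Qed.

Lemma nrm_scalar r : 0 <= r -> nrm (r *: (1 : B)) <= r.
Proof. by move=> r0; rewrite nrmZ ger0_norm// ler_piMr// nrm1. Qed.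

(** * Norm convergence with real tolerances, and completeness *)

Definition converges (u : nat -> B) (l : B) : Prop :=
  forall e : R, 0 < e ->
    exists N : nat, forall n, (N <= n)%N -> nrm (u n - l) <= e.

Lemma converges_bounded_variation (u : nat -> B) (a : nat -> R) (M : R) :
  (forall n, nrm (u n.+1 - u n) <= a n.+1 - a n) -> (forall n, a n <= M) ->
  exists l, converges u l.
Proof.
move=> ua aM.
have uam N k : nrm (u (N + k)%N - u N) <= a (N + k)%N - a N.
  elim: k => [|k IH]; first by rewrite addn0 !subrr nrm0.
  rewrite addnS -(subrKA (u (N + k)%N)) (le_trans (nrmD _ _))//.
  by have := ua (N + k)%N; lra.
have supa : has_sup (range a).
  by split; [exists (a 0%N); exists 0%N|exists M => _ [n _ <-]].
have cvu : cvg ((u : nat -> A) @ \oo).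
  apply/cauchy_cvgP/cauchy_exP => e e0.
  have re0 : 0 < complex.Re e by move: e0; rewrite ltcE /= => /andP[].
  have ee : e = (complex.Re e)%:C by rewrite RRe_real// gtr0_real.
  (* Once [a] is within [e] of its supremum, its later increments, and hence those of [u], stay
     below [e]. *)
  have [_ [N _ <-] aN] := sup_adherent re0 supa.
  exists (u N); exists N => // m /= Nm.
  rewrite -ball_normE /= ee (_ : `|_ - _| = (nrm (u N - u m))%:C) ?nrmE// ltcR.
  rewrite nrm_dist -(subnKC Nm); apply: le_lt_trans (uam _ _) _.
  have : a (N + (m - N))%N <= sup (range a).
    by apply: ub_le_sup; [exact: supa.2|exists (N + (m - N))%N].
  lra.
exists (lim ((u : nat -> A) @ \oo)) => e e0.
have /cvgrPdist_le /(_ e%:C)[|N _ uN] := cvu; first by rewrite ltcR.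
exists N => n Nn; have := uN n Nn.
rewrite /= (_ : `|_ - _| = (nrm (lim ((u : nat -> A) @ \oo) - u n))%:C) ?nrmE//.
by rewrite lecR nrm_dist.
Qed.

End RealAlgebra.

(** * Positive elements *)

Section Positivity.
Variables (R : realType) (A : cstarAlgType R).
Local Notation B := (realified A).
Local Notation one := (1 : B).
Implicit Types (x y z h k a : B) (r s t e : R).

Lemma scale_two x : (2 : R) *: x = x + x.
Proof. by rewrite scaler_nat mulr2n. Qed.

Lemma scale_half x : 2^-1 *: (x + x) = x.
Proof. by rewrite -scale_two scalerA mulVf ?scale1r// pnatr_eq0. Qed.

(** Used to pass identities to limits; [r] collects the constants of the estimate. Dividing by
    [|r| + 1] covers every sign of [r]. *)
Lemma nrm_small r x : (forall e, 0 < e -> nrm x <= r * e) -> x = 0.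
Proof.
move=> xe; apply/nrm0P/ler_addgt0Pr => e e0; rewrite add0r.
have r0 : 0 < `|r| + 1 by rewrite ltr_wpDl.
apply: le_trans (xe _ (divr_gt0 e0 r0)) _; rewrite mulrCA ler_piMr ?(ltW e0)//.
by rewrite ler_pdivrMr// mul1r (le_trans (ler_norm r))// lerDl.
Qed.

Lemma converges_close (u : nat -> B) x e : converges u x -> 0 < e ->
  exists n, nrm (u n - x) <= e /\ nrm (u n.+1 - x) <= e.
Proof.
by move=> ux e0; have [n un] := ux e e0; exists n; split; apply: un.
Qed.

Lemma converges_bound (u : nat -> B) x r :
  converges u x -> (forall n, nrm (u n) <= r) -> nrm x <= r.
Proof.
move=> ux ur; apply/ler_addgt0Pr => e e0.
have [n [un _]] := converges_close ux e0.
have := nrmB (u n) (u n - x); rewrite opprB addrC subrK; have := ur n; lra.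
Qed.

Lemma converges_sa (u : nat -> B) x :
  converges u x -> (forall n, star (u n) = u n) -> star x = x.
Proof.
move=> ux us; apply/eqP; rewrite -subr_eq0; apply/eqP.
apply: (@nrm_small 2) => e e0; have [n [un _]] := converges_close ux e0.
rewrite -(subrKA (u n)) -{1}us -starN -starD (le_trans (nrmD _ _))// nrm_star.
by rewrite nrm_dist; lra.
Qed.

Lemma converges_comm (u : nat -> B) x z :
  converges u x -> (forall n, GRing.comm (u n) z) -> GRing.comm x z.
Proof.
move=> ux uz; apply/eqP; rewrite -subr_eq0; apply/eqP.
apply: (@nrm_small (2 * nrm z)) => e e0.
have [n [un _]] := converges_close ux e0.
rewrite -(subrKA (u n * z)) {2}uz -mulrBl -mulrBr (le_trans (nrmD _ _))//.
have := nrmM (x - u n) z; have := nrmM z (u n - x).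
rewrite (nrm_dist x); have := nrm_ge0 z; nra.
Qed.

Lemma scalar_comm r z : GRing.comm (r *: one) z.
Proof. by rewrite /GRing.comm -scale_mull -scale_mulr mul1r mulr1. Qed.

Lemma commZ r x z : GRing.comm x z -> GRing.comm (r *: x) z.
Proof. by rewrite /GRing.comm -scale_mull -scale_mulr => ->. Qed.

Lemma commD x y z : GRing.comm x z -> GRing.comm y z -> GRing.comm (x + y) z.
Proof. by rewrite /GRing.comm mulrDl mulrDr => -> ->. Qed.

Lemma commN x z : GRing.comm x z -> GRing.comm (- x) z.
Proof. by rewrite /GRing.comm mulNr mulrN => ->. Qed.

Lemma comm_oneB x z : GRing.comm x z -> GRing.comm (1 - x) z.
Proof. by rewrite /GRing.comm mulrBl mulrBr mul1r mulr1 => ->. Qed.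

Lemma commM x y z : GRing.comm x z -> GRing.comm y z -> GRing.comm (x * y) z.
Proof. by rewrite /GRing.comm => xz yz; rewrite -mulrA yz mulrA xz mulrA. Qed.

(* A fixed point y satisfies (1 - y)^2 = 1 - x. *)
Definition sqrt_step x y : B := 2^-1 *: (x + y * y).
Definition sqrt_iter x (n : nat) : B := iter n (sqrt_step x) 0.

Lemma sqrt_iterS x n : sqrt_iter x n.+1 = sqrt_step x (sqrt_iter x n).
Proof. by []. Qed.

Lemma sqr_diff y z : y * y - z * z = y * (y - z) + (y - z) * z.
Proof. by rewrite mulrBr mulrBl addrA subrK. Qed.

(** Separate bounds [r] and [s] are kept so that, for consecutive scalar iterates, the factor
    [(r + s) / 2] reproduces exactly the scalar increment. *)
Lemma sqrt_step_diff x y z r s : nrm y <= r -> nrm z <= s ->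
  nrm (sqrt_step x y - sqrt_step x z) <= 2^-1 * ((r + s) * nrm (y - z)).
Proof.
move=> yr zs; rewrite /sqrt_step -scalerBr opprD addrACA subrr.
rewrite add0r nrmZ ger0_norm ?invr_ge0//.
rewrite ler_wpM2l ?invr_ge0// sqr_diff (le_trans (nrmD _ _))//.
have := nrmM y (y - z); have := nrmM (y - z) z.
have := nrm_ge0 (y - z); have := nrm_ge0 y; have := nrm_ge0 z; nra.
Qed.

Lemma sqrt_iter_sa x n : star x = x -> star (sqrt_iter x n) = sqrt_iter x n.
Proof.
move=> xs; elim: n => [|n IH]; first exact: star0.
by rewrite sqrt_iterS /sqrt_step starZ starD starM IH xs.
Qed.

Lemma sqrt_iter_comm x z n : GRing.comm x z -> GRing.comm (sqrt_iter x n) z.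
Proof.
move=> xz; elim: n => [|n IH]; first by rewrite /GRing.comm mul0r mulr0.
rewrite sqrt_iterS /sqrt_step /GRing.comm -scale_mull -scale_mulr.
by rewrite mulrDl mulrDr xz -mulrA IH mulrA IH mulrA.
Qed.

(* The iterates are polynomials in x with nonnegative coefficients, so their
   norms are dominated by the same iteration run on the scalar 1. *)
Lemma sqrt_iter_converges x : nrm x <= 1 ->
  (forall n, nrm (sqrt_iter x n) <= 1) /\ exists y, converges (sqrt_iter x) y.
Proof.
move=> x1; pose c n := iter n (fun s => 2^-1 * (1 + s * s)) (0 : R).
have cS n : c n.+1 = 2^-1 * (1 + c n * c n) by [].
have c01 n : 0 <= c n <= 1.
  by elim: n => [|n IH]; rewrite ?cS /=; [rewrite /c/= lexx ler01|nra].
have yc n : nrm (sqrt_iter x n) <= c n.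
  elim: n => [|n IH]; first by rewrite nrm0.
  rewrite sqrt_iterS cS nrmZ ger0_norm ?invr_ge0// ler_wpM2l ?invr_ge0//.
  apply: le_trans (nrmD _ _) _; have := nrmM (sqrt_iter x n) (sqrt_iter x n).
  have := nrm_ge0 (sqrt_iter x n); nra.
have y1 n : nrm (sqrt_iter x n) <= 1 by have := yc n; have := c01 n; lra.
split=> //; apply: (@converges_bounded_variation _ _ _ c 1) => n; last first.
  by have /andP[] := c01 n.
elim: n => [|n IH].
  by have := yc 1%N; rewrite /c /sqrt_iter /= !subr0.
have := sqrt_step_diff x (yc n.+1) (yc n); rewrite -!sqrt_iterS => /le_trans.
apply; move: IH (cS n.+1) (cS n) (c01 n) (c01 n.+1); nra.
Qed.

Lemma sqrt_iter_limit x y : nrm x <= 1 -> converges (sqrt_iter x) y ->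
  (1 - y) * (1 - y) = 1 - x.
Proof.
move=> x1 xy; have [u1 _] := sqrt_iter_converges x1.
have y1 := converges_bound xy u1.
(* The step is 1-Lipschitz on the unit ball, so it moves the limit by at most [2 * e]. *)
have : sqrt_step x y - y = 0.
  apply: (@nrm_small 2) => e e0; have [n [un un1]] := converges_close xy e0.
  rewrite -(subrKA (sqrt_iter x n.+1)) (le_trans (nrmD _ _))//.
  have := sqrt_step_diff x y1 (u1 n); rewrite -sqrt_iterS (nrm_dist y).
  lra.
move/eqP; rewrite subr_eq0 => /eqP ye.
have -> : x = y + y - y * y.
  by rewrite -{1 2}ye -scalerDl (_ : _ + _ = 1 :> R) ?scale1r ?addrK//; lra.
by rewrite mulrBl mul1r mulrBr mulr1 -addrA -opprD addrA.
Qed.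

(** For self-adjoint [x] the bound says that the spectrum lies in [[0, 2r]]. In this form sums of
    positive elements are visibly positive, which is not apparent for elements [star y * y]. *)
Definition pos x : Prop := star x = x /\ exists r, nrm (r *: one - x) <= r.

Lemma sa_scalar r : star (r *: one) = r *: one.
Proof. by rewrite starZ star1. Qed.

Lemma sa_sqr h : star h = h -> star (h * h) = h * h.
Proof. by move=> hs; rewrite starM hs. Qed.

Lemma posD x y : pos x -> pos y -> pos (x + y).
Proof.
move=> [xs [r xr]] [ys [s ys']]; split; first by rewrite starD xs ys.
exists (r + s); rewrite scalerDl opprD addrACA (le_trans (nrmD _ _))//.
exact: lerD.
Qed.

Lemma posZ r x : 0 <= r -> pos x -> pos (r *: x).
Proof.
move=> r0 [xs [s xle]]; split; first by rewrite starZ xs.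
by exists (r * s); rewrite -scalerA -scalerBr nrmZ ger0_norm// ler_wpM2l.
Qed.

Lemma pos_scalarB r x : star x = x -> nrm x <= r -> pos (r *: one - x).
Proof.
move=> xs xr; split; first by rewrite starD starN sa_scalar xs.
by exists r; rewrite subKr.
Qed.

Lemma pos_scalarD r x : star x = x -> nrm x <= r -> pos (r *: one + x).
Proof.
by move=> xs xr; rewrite -[x]opprK; apply: pos_scalarB; rewrite ?starN ?xs ?nrmN.
Qed.

Lemma pos_scalar r : 0 <= r -> pos (r *: one).
Proof.
move=> r0; rewrite -[_ *: _]subr0; apply: pos_scalarB; [exact: star0|].
by rewrite nrm0.
Qed.

Lemma pos_scalar_sub r s x : r <= s -> pos (r *: one - x) -> pos (s *: one - x).
Proof.
move=> rs px; rewrite -(subrK (r *: one) (s *: one)) -addrA -scalerBl.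
by apply: posD => //; apply: pos_scalar; rewrite subr_ge0.
Qed.

(** The root is a limit of polynomials in [x], so it commutes with whatever commutes with [x]; later
    arguments multiply roots of commuting elements. *)
Lemma sqrt_one_sub x : star x = x -> nrm x <= 1 ->
  exists k, [/\ star k = k, k * k = 1 - x
    & forall z, GRing.comm x z -> GRing.comm k z].
Proof.
move=> xs x1; have [_ [y xy]] := sqrt_iter_converges x1.
exists (1 - y); split=> [||z xz].
- rewrite starD starN star1 (converges_sa xy)// => n; exact: sqrt_iter_sa.
- exact: sqrt_iter_limit xy.
exact: comm_oneB (converges_comm xy (fun n => sqrt_iter_comm n xz)).
Qed.

Lemma sqr_scale r x : (r *: x) * (r *: x) = (r ^+ 2) *: (x * x).
Proof. by rewrite -scale_mull -scale_mulr scalerA -expr2. Qed.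

(** If [r > 0], then [u = 1 - x / r] has norm at most 1 and [1 - u = x / r] has a root; if [r <= 0],
    the bound forces [x = 0]. *)
Lemma pos_sqrt x : pos x ->
  exists h, [/\ star h = h, h * h = x
    & forall z, GRing.comm x z -> GRing.comm h z].
Proof.
move=> [xs [r xr]].
have [r0|r0] := ltP 0 r; last first.
  have : r *: one - x = 0 by apply: nrm0P; apply: le_trans r0.
  have r0' : r = 0 by apply/le_anti; rewrite r0 (le_trans (nrm_ge0 _) xr).
  rewrite r0' scale0r sub0r => /eqP; rewrite oppr_eq0 => /eqP ->.
  by exists 0; rewrite star0 mul0r; split.
pose u := 1 - r^-1 *: x.
have us : star u = u by rewrite /u starD starN starZ star1 xs.
have u1 : nrm u <= 1.
  have -> : u = r^-1 *: (r *: one - x).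
    by rewrite scalerBr scalerA mulVf ?scale1r// gt_eqF.
  by rewrite nrmZ gtr0_norm ?invr_gt0// mulrC ler_pdivrMr// mul1r.
have [k [ks kk kc]] := sqrt_one_sub us u1.
exists (Num.sqrt r *: k); split=> [||z xz].
- by rewrite starZ ks.
- by rewrite sqr_scale kk sqr_sqrtr ?ltW// subKr scalerA divff ?scale1r// gt_eqF.
by apply/commZ/kc/comm_oneB/commZ.
Qed.

(* h + ik is unitary. *)
Lemma nrm_unitary h k : star h = h -> star k = k -> GRing.comm h k ->
  h * h + k * k = 1 -> nrm h <= 1.
Proof.
move=> hs ks hk hk1; pose u := h + muli k.
have us : star u = h - muli k by rewrite /u starD star_muli hs ks.
have uu : star u * u = 1.
  have hm : h * muli k = muli k * h by rewrite -muli_mulr -muli_mull hk.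
  have mm : muli k * muli k = - (k * k) by rewrite -muli_mull -muli_mulr muliK.
  by rewrite us /u mulrDr !mulrBl hm mm opprK subrKA.
have u1 : nrm u <= 1.
  by have := nrm_starM u; rewrite uu; have := nrm1 A; have := nrm_ge0 u; nra.
have := nrmD u (star u); rewrite nrm_star us /u addrACA subrr addr0 -mulr2n.
rewrite -scaler_nat nrmZ ger0_norm//; lra.
Qed.

(** A root [k] of [1 - h * h] commutes with [h], so [k + ih] is unitary and [nrm k <= 1]; the claim
    is the square of this bound. *)
Lemma nrm_one_sub_sqr h : star h = h -> nrm h <= 1 -> nrm (1 - h * h) <= 1.
Proof.
move=> hs h1.
have h21 : nrm (h * h) <= 1 by rewrite nrm_sqr// expr_le1// nrm_ge0.
have [k [ks kk kc]] := sqrt_one_sub (sa_sqr hs) h21.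
have kh : GRing.comm k h by apply: kc; rewrite /GRing.comm mulrA.
rewrite -kk nrm_sqr// expr_le1// ?nrm_ge0//.
by apply: (nrm_unitary ks hs kh); rewrite kk subrK.
Qed.

Lemma nrm_scalar_sub_sqr r h : star h = h -> nrm h <= r ->
  nrm (r ^+ 2 *: one - h * h) <= r ^+ 2.
Proof.
move=> hs hr; have := le_trans (nrm_ge0 h) hr.
rewrite le_eqVlt => /predU1P[r0|r0].
  move: hr; rewrite -r0 => /nrm0P ->.
  by rewrite mul0r subr0 expr0n scale0r nrm0.
have -> : r ^+ 2 *: one - h * h = r ^+ 2 *: (1 - (r^-1 *: h) * (r^-1 *: h)).
  by rewrite sqr_scale scalerBr scalerA exprVn divff ?scale1r// expf_neq0// gt_eqF.
rewrite nrmZ ger0_norm ?sqr_ge0// ler_piMr ?sqr_ge0//.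
apply: nrm_one_sub_sqr; first by rewrite starZ hs.
by rewrite nrmZ gtr0_norm ?invr_gt0// mulrC ler_pdivrMr// mul1r.
Qed.

Lemma pos_sqr h : star h = h -> pos (h * h).
Proof.
move=> hs; split; first exact: sa_sqr.
by exists (nrm h ^+ 2); apply: nrm_scalar_sub_sqr.
Qed.

(** The radius in [pos] is existential; writing [x] as a square shows that every [r] above the norm
    serves. This uniformity makes the cone closed. *)
Lemma pos_dist x r : pos x -> nrm x <= r -> nrm (r *: one - x) <= r.
Proof.
move=> px xr; have [h [hs hh _]] := pos_sqrt px.
have r0 := le_trans (nrm_ge0 x) xr.
rewrite -hh -[r](sqr_sqrtr r0); apply: nrm_scalar_sub_sqr => //.
rewrite -(@ler_pXn2r _ 2) ?nnegrE ?nrm_ge0 ?sqrtr_ge0// sqr_sqrtr//.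
by rewrite -nrm_sqr// hh.
Qed.

(** The roots [h] and [k] commute as well, so the product is the square of the self-adjoint element
    [h * k]. *)
Lemma pos_mul x y : pos x -> pos y -> GRing.comm x y -> pos (x * y).
Proof.
move=> px py xy; have [h [hs hh hc]] := pos_sqrt px.
have [k [ks kk kc]] := pos_sqrt py.
have kh : GRing.comm k h by apply: kc; apply/commr_sym/hc.
have -> : x * y = (h * k) * (h * k).
  by rewrite -hh -kk -!mulrA [k * (h * k)]mulrA kh !mulrA.
by apply: pos_sqr; rewrite starM hs ks kh.
Qed.

Lemma pos_nrm_le r x : 0 <= r -> pos x -> pos (r *: one - x) -> nrm x <= r.
Proof.
(* Enlarging [r] to [t > 0] permits division: [x / t] and [1 - x / t] have commuting roots whose
   squares sum to 1, so [nrm_unitary] applies. *)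
move=> r0 px prx; apply/ler_addgt0Pr => e e0; set t := r + e.
have t0 : 0 < t by rewrite ltr_wpDl.
have ptx : pos (t *: one - x) by apply: pos_scalar_sub prx; rewrite lerDl ltW.
have ti0 : 0 <= t^-1 by rewrite invr_ge0 ltW.
have [h [hs hh hc]] := pos_sqrt (posZ ti0 px).
have [k [ks kk kc]] := pos_sqrt (posZ ti0 ptx).
have hx : GRing.comm x h by apply/commr_sym/hc/commZ.
have hk : GRing.comm h k.
  apply/commr_sym/kc/commZ/commD; first exact: scalar_comm.
  exact: commN.
have : nrm h <= 1.
  apply: (nrm_unitary hs ks hk).
  by rewrite hh kk -scalerDr addrC subrK scalerA mulVf ?scale1r// gt_eqF.
move=> h1; have : nrm (t^-1 *: x) <= 1.
  by rewrite -hh nrm_sqr// expr_le1// nrm_ge0.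
by rewrite nrmZ ger0_norm// mulrC ler_pdivrMr// mul1r.
Qed.

(** The element [r + x] lies between 0 and [2 * r], so has norm at most [2 * r]; removing [r] costs
    another [r], whence the 3. *)
Lemma nrm_le_order r x : star x = x -> pos (r *: one + x) ->
  pos (r *: one - x) -> 0 <= r -> nrm x <= 3 * r.
Proof.
move=> xs p1 p2 r0; have : nrm (r *: one + x) <= 2 * r.
  apply: pos_nrm_le => //; first by rewrite mulr_ge0.
  by rewrite opprD addrA -scalerBl (_ : 2 * r - r = r)//; ring.
have := nrmB (r *: one + x) (r *: one); rewrite addrC addKr.
have := @nrm_scalar _ A r r0; lra.
Qed.

Lemma pos_closed (u : nat -> B) x :
  converges u x -> (forall n, pos (u n)) -> pos x.
Proof.
move=> ux pu; split; first by apply: converges_sa ux _ => n; have [] := pu n.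
(* One radius for all [u n] within distance 1 of [x], which explains the minimum with 1 below. *)
exists (nrm x + 1); apply/ler_addgt0Pr => e e0.
have m0 : 0 < Num.min e 1 by rewrite lt_min e0 ltr01.
have [n [un _]] := converges_close ux m0.
have ue : nrm (u n - x) <= e by apply: le_trans un _; rewrite ge_min lexx.
have u1 : nrm (u n - x) <= 1 by apply: le_trans un _; rewrite ge_min lexx orbT.
have unx : nrm (u n) <= nrm x + 1.
  by have := nrmD (u n - x) x; rewrite subrK; lra.
have := pos_dist (pu n) unx.
have := nrmD ((nrm x + 1) *: one - u n) (u n - x); rewrite subrKA; lra.
Qed.

(** * Absolute values, and positivity of [star y * y] *)

Lemma sqr_sub_comm y z : GRing.comm y z ->
  z * z - y * y = (z - y) * (z + y).
Proof. by move=> yz; rewrite mulrDr !mulrBl yz subrKA. Qed.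

(** The new gap is half of [(1 - a)^2 - y^2]. Factored, it becomes a product of commuting elements,
    so positivity passes from one gap to the next by [pos_mul]. *)
Lemma abs_step y a : GRing.comm y a ->
  1 - sqrt_step (1 - a * a) y - a = 2^-1 *: ((1 - a - y) * (y + (1 - a))).
Proof.
move=> ya; have yz : GRing.comm y (1 - a) by apply/commr_sym/comm_oneB/commr_sym.
rewrite [y + _]addrC -(sqr_sub_comm yz) /sqrt_step.
have -> (P : B) : one - 2^-1 *: P - a = 2^-1 *: (one + one - P - (a + a)).
  by rewrite !scalerBr !scale_half.
congr (_ *: _); rewrite mulrBl mul1r mulrBr mulr1 !opprB !opprD !addrA addrK.
by rewrite opprK [LHS](ACl (1*4*2*5*3)).
Qed.

(* The iterates decrease to |a|, so they dominate a. *)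
Lemma abs_iter_sub a n : star a = a -> nrm a <= 1 ->
  pos (1 - sqrt_iter (1 - a * a) n - a).
Proof.
move=> as_ a1.
have a2s : nrm (1 - a * a) <= 1 by exact: nrm_one_sub_sqr.
have xs : star (1 - a * a) = 1 - a * a by rewrite starD starN star1 sa_sqr.
have px : pos (1 - a * a).
  rewrite -(scale1r one); apply: pos_scalarB; first exact: sa_sqr.
  by rewrite nrm_sqr// expr_le1// nrm_ge0.
have p1a : pos (1 - a) by rewrite -(scale1r one); apply: pos_scalarB.
have ay m : GRing.comm (sqrt_iter (1 - a * a) m) a.
  by apply/sqrt_iter_comm/comm_oneB/commM.
have py m : pos (sqrt_iter (1 - a * a) m).
  case: m => [|m].
    by have := pos_scalar (lexx (0 : R)); rewrite scale0r.
  rewrite sqrt_iterS; apply: posZ; first by rewrite invr_ge0.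
  by apply: posD => //; apply: pos_sqr; exact: sqrt_iter_sa.
elim: n => [|n IH]; first by rewrite subr0.
rewrite sqrt_iterS abs_step//; apply: posZ; first by rewrite invr_ge0.
apply: pos_mul; [by rewrite addrAC|exact: posD|].
have cz z : GRing.comm (sqrt_iter (1 - a * a) n) z -> GRing.comm a z ->
    GRing.comm (1 - a - sqrt_iter (1 - a * a) n) z.
  by move=> yz /comm_oneB az; apply: commD => //; exact: commN.
apply: commr_sym; apply: commD; last apply: comm_oneB.
  by apply/commr_sym/cz => //; exact: commr_sym.
by apply/commr_sym/cz.
Qed.

(** Here [b = |a|] is one minus the limit of the iteration. The iteration sees only [a * a], so
    [abs_iter_sub] applies to both [a] and [- a], and the bounds survive in the limit. *)
Lemma abs_exists a : star a = a -> nrm a <= 1 ->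
  exists b : B, [/\ star b = b, b * b = a * a, GRing.comm b a,
    pos (b - a) & pos (b + a)].
Proof.
move=> as_ a1; set x := 1 - a * a.
have xs : star x = x by rewrite /x starD starN star1 sa_sqr.
have x1 : nrm x <= 1 by exact: nrm_one_sub_sqr.
have [_ [y xy]] := sqrt_iter_converges x1.
have ax : GRing.comm x a.
  by apply/comm_oneB/commM.
have cvB b : converges (fun n => 1 - sqrt_iter x n - b) (1 - y - b).
  move=> e /xy[N yN]; exists N => n /yN.
  by rewrite opprD addrACA subrr addr0 opprB addrC addrA subrK nrm_dist.
have ys : star y = y by apply: converges_sa xy _ => n; exact: sqrt_iter_sa.
exists (1 - y); split.
- by rewrite starD starN star1 ys.
- by rewrite (sqrt_iter_limit x1 xy) subKr.
- by apply/comm_oneB/(converges_comm xy) => n; exact: sqrt_iter_comm.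
- by apply: pos_closed (cvB a) _ => n; exact: abs_iter_sub.
- rewrite -[a]opprK; apply: pos_closed (cvB (- a)) _ => n.
  rewrite /x -[a * a]mulrNN; apply: abs_iter_sub; last by rewrite nrmN.
  by rewrite starN as_.
Qed.

(* z^* z + z z^* is a sum of two squares of self-adjoint elements, so
   -z^* z >= 0 forces z z^* >= 0; comparing the norms of z (|z|^2 + z^* z) z^* and of
   |z|^2 z z^* + (z z^* )^2 then gives z = 0. *)
Lemma sqr_neg_eq0 z : pos (- (star z * z)) -> z = 0.
Proof.
move=> pb; pose b : B := star z * z; pose c : B := z * star z.
pose s := nrm z ^+ 2.
have bs : star b = b by rewrite /b starM starK.
have cs : star c = c by rewrite /c starM starK.
have nc : nrm c = s by have := nrm_starM (star z); rewrite starK nrm_star.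
have s0 : 0 <= s by exact: sqr_ge0.
have pbc : pos ((2 : R) *: (b + c)).
  pose p := z + star z; pose q := muli (z - star z).
  have ps : star p = p by rewrite /p starD starK addrC.
  have qs : star q = q by rewrite /q star_muli starD starN starK -muliN opprB.
  have -> : (2 : R) *: (b + c) = p * p + q * q.
    rewrite /q -muli_mull -muli_mulr muliK /p /b /c.
    rewrite !(mulrDl, mulrDr, mulrN, mulNr, opprD, opprK) !addrA.
    rewrite [RHS](ACl (3*2*(7*6)*(1*5)*(4*8))) /= !subrr !addr0.
    exact: scale_two.
  by apply: posD; apply: pos_sqr.
have pc : pos c.
  have -> : c = (2^-1 : R) *: ((2 : R) *: (b + c)) - b.
    by rewrite scale_two scale_half [b + c]addrC addrK.
  by apply: posD => //; apply: posZ; rewrite ?invr_ge0.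
have sb : nrm (s *: one + b) <= s.
  by rewrite -[b]opprK; apply: pos_dist; rewrite ?nrmN ?nrm_starM.
have zbz : z * (s *: one + b) * star z = s *: c + c * c.
  by rewrite mulrDr mulrDl -scale_mulr mulr1 -scale_mull /b /c !mulrA.
have n1 : nrm (s *: c + c * c) <= s ^+ 2.
  rewrite -zbz (le_trans (nrmM _ _))// nrm_star.
  have := nrmM z (s *: one + b); have := nrm_ge0 z.
  have -> : s ^+ 2 = nrm z * s * nrm z by rewrite /s; ring.
  move=> z0 h; rewrite ler_wpM2r//; apply: le_trans h _; rewrite ler_wpM2l//.
have p1 : pos (s ^+ 2 *: one - (s *: c + c * c)).
  by apply: pos_scalarB => //; rewrite starD starZ starM cs.
(* Adding this square to [p1] cancels [c * c] and leaves [5/4 s^2 - 2 s c >= 0]. As [nrm c = s],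
   this yields [2 s^2 <= 5/4 s^2], so [s = 0]. *)
have p2 : pos ((c - (s / 2) *: one) * (c - (s / 2) *: one)).
  by apply: pos_sqr; rewrite starD starN sa_scalar cs.
have p3 : pos ((5 / 4 * s ^+ 2) *: one - (2 * s) *: c).
  have := posD p1 p2; congr pos.
  rewrite mulrBl !mulrBr -!scale_mull -!scale_mulr !mul1r mulr1 !scalerA.
  have -> : 5 / 4 * s ^+ 2 = s ^+ 2 + s / 2 * (s / 2) by field.
  have -> : 2 * s = s + s / 2 + s / 2 by field.
  rewrite !scalerDl !opprB !opprD !addrA subrK.
  by rewrite [RHS](ACl (1*3*4*2*5)).
have : nrm ((2 * s) *: c) <= 5 / 4 * s ^+ 2.
  by apply: pos_nrm_le p3; [nra|apply: posZ => //; lra].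
have s2 : 0 <= 2 * s by lra.
rewrite nrmZ nc (ger0_norm s2) => h.
have s00 : s = 0 by nra.
apply: nrm0P; have : nrm z ^+ 2 = 0 by [].
by move/eqP; rewrite expf_eq0 /= => /eqP ->.
Qed.

(* Kaplansky: with a = y^* y and q the negative part of a, (yq)^* (yq) = - q^3. *)
Lemma pos_starM y : pos (star y * y).
Proof.
wlog y1 : y / nrm y <= 1 => [wl|].
  have [y0|y0] := ltP 0 (nrm y); last first.
    by rewrite (nrm0P y0) mulr0 -(scale0r one); apply: pos_scalar.
  have := wl ((nrm y)^-1 *: y); rewrite nrmZ ger0_norm ?invr_ge0 ?nrm_ge0//.
  rewrite mulVf ?gt_eqF// lexx => /(_ isT) /(posZ (ltW (exprn_gt0 2 y0))).
  rewrite starZ -scale_mull -scale_mulr !scalerA -mulrA -expr2 -exprMn.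
  rewrite mulfV ?gt_eqF//.
  by rewrite expr1n scale1r.
set a := star y * y.
have as_ : star a = a by rewrite /a starM starK.
have a1 : nrm a <= 1 by rewrite nrm_starM expr_le1// nrm_ge0.
have [r [rs rr ra pq pp]] := abs_exists as_ a1.
(* With [r = |a|], this is twice the negative part, which accounts for the factor 1/2 in [aq]. *)
set q := r - a.
have qs : star q = q by rewrite /q starD starN rs as_.
have qq : GRing.comm q q by [].
have aq : a * q = - (2^-1 *: (q * q)).
  have -> : q * q = - (a * q + a * q).
    have rq : r * q = - (a * q) by rewrite /q !mulrBr rr ra opprB.
    by rewrite {1}/q mulrBl rq opprD.
  by rewrite scalerN opprK scale_half.
have : pos (- (star (y * q) * (y * q))).
  rewrite starM qs mulrA -[q * star y * y]mulrA -/a -mulrA aq mulrN opprK.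
  rewrite -scale_mulr; apply: posZ; rewrite ?invr_ge0//.
  by apply: pos_mul; [|exact: pos_sqr|exact: mulrA].
move/sqr_neg_eq0 => yq0.
have aq0 : a * q = 0 by rewrite /a -mulrA yq0 mulr0.
have q0 : q = 0.
  move/eqP: aq; rewrite aq0 eq_sym oppr_eq0 => /eqP.
  move/(congr1 (fun x => nrm (2 *: x))).
  rewrite scaler0 nrm0 scalerA divff ?pnatr_eq0// scale1r nrm_sqr// => /eqP.
  by rewrite expf_eq0 /= => /eqP qn; apply: nrm0P; rewrite qn.
have -> : a = 2^-1 *: (r + a).
  have -> : r = a by apply/eqP; rewrite -subr_eq0 -/q q0.
  by rewrite scale_half.
by apply: posZ; rewrite ?invr_ge0.
Qed.

End Positivity.

(** * The Hahn-Banach theorem *)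

Section HahnBanach.
Variables (R : realType) (V : lmodType R).
Implicit Types (p q : V -> R) (x y : V) (r : R).

(** Homogeneity is only an inequality, for positive [r], so that it is easy to check for infima;
    equality and the value at 0 follow. *)
Definition sublinear p : Prop :=
  (forall x y, p (x + y) <= p x + p y) /\
  (forall r x, 0 < r -> p (r *: x) <= r * p x).

Lemma sublinearZ p r x : sublinear p -> 0 < r -> p (r *: x) = r * p x.
Proof.
move=> [_ pZ] r0; apply/le_anti; rewrite pZ//=.
have := pZ r^-1 (r *: x); rewrite invr_gt0 scalerA mulVf ?gt_eqF// scale1r.
by move=> /(_ r0); rewrite mulrC ler_pdivlMr// mulrC.
Qed.

Lemma sublinear0 p : sublinear p -> p 0 = 0.
Proof.
by move=> sp; have := @sublinearZ p 2 0 sp; rewrite scaler0 => /(_ ltac:(lra)); lra.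
Qed.

Lemma sublinear_opp p x : sublinear p -> - p (- x) <= p x.
Proof.
by move=> sp; have := sp.1 x (- x); rewrite subrr sublinear0//; lra.
Qed.

(** One criterion for three uses: tilts, lower bounds of chains, and the limit superior of
    averages. *)
Lemma sublinear_inf (D : V -> set R) :
  (forall x, has_inf (D x)) ->
  (forall x y a b, D x a -> D y b -> exists2 c, D (x + y) c & c <= a + b) ->
  (forall r x a, 0 < r -> D x a -> exists2 c, D (r *: x) c & c <= r * a) ->
  sublinear (fun x => inf (D x)).
Proof.
move=> Dinf DD DZ; split=> [x y|r x r0].
  rewrite -lerBlDr; apply: lb_le_inf; first exact: (Dinf x).1.
  move=> a Da; rewrite lerBlDr -lerBlDl; apply: lb_le_inf; first exact: (Dinf y).1.
  move=> b Db; rewrite lerBlDl; have [c Dc] := DD _ _ _ _ Da Db.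
  by apply: le_trans; apply: ge_inf => //; exact: (Dinf _).2.
rewrite mulrC -ler_pdivrMr//; apply: lb_le_inf; first exact: (Dinf x).1.
move=> a Da; rewrite ler_pdivrMr// mulrC; have [c Dc] := DZ _ _ _ r0 Da.
by apply: le_trans; apply: ge_inf => //; exact: (Dinf _).2.
Qed.

(** The tilt is the infimum over [t > 0] of [p (x + t *: y) - t * p y]. Subadditivity bounds it
    below by [- p (- x)], and [t = 1] gives both upper bounds. *)
Lemma sublinear_tilt p y : sublinear p ->
  exists q, [/\ sublinear q, forall x, q x <= p x
    & forall x, q x <= p (x + y) - p y].
Proof.
move=> sp; pose D x := [set p (x + t *: y) - t * p y | t in [set t : R | 0 < t]].
have Dinf x : has_inf (D x).
  split; first by exists (p (x + 1 *: y) - 1 * p y); exists 1 => /=.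
  exists (- p (- x)) => _ [t /= t0 <-]; have := sp.1 (x + t *: y) (- x).
  by rewrite addrC addKr sublinearZ//; lra.
have Dle x t : 0 < t -> inf (D x) <= p (x + t *: y) - t * p y.
  by move=> t0; apply: ge_inf; [exact: (Dinf x).2|exists t].
exists (fun x => inf (D x)); split=> [|x|x].
- apply: sublinear_inf => //
    [x z _ _ [s /= s0 <-] [t /= t0 <-]|r x _ r0 [t /= t0 <-]].
    eexists; first by exists (s + t); [exact: addr_gt0|reflexivity].
    by have := sp.1 (x + s *: y) (z + t *: y); rewrite addrACA -scalerDl; lra.
  eexists; first by exists (r * t); [exact: mulr_gt0|reflexivity].
  by have := sp.2 r (x + t *: y) r0; rewrite scalerDr scalerA; lra.
- have := Dle x 1 ltr01; have := sp.1 x (1 *: y).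
  by rewrite sublinearZ//; lra.
- by have := Dle x 1 ltr01; rewrite scale1r mul1r.
Qed.

Lemma sublinear_minimal p : sublinear p ->
  exists q, [/\ sublinear q, forall x, q x <= p x
    & forall q', sublinear q' -> (forall x, q' x <= q x) -> q' = q].
Proof.
move=> sp; pose T := {q | sublinear q /\ forall x, q x <= p x}.
(* The order is reversed, so that a maximal element for Zorn is a minimal functional. *)
pose le (s t : T) := `[< forall x, sval t x <= sval s x >].
have [|s t u /asboolP st /asboolP tu|s t /asboolP st /asboolP ts|F tot|] :=
    @Zorn T le.
- by move=> t; apply/asboolP.
- by apply/asboolP => x; exact: le_trans (tu x) (st x).
- move: s t st ts => [qs hs] [qt ht] /= st ts.
  apply: eq_exist; apply/funext => x; apply/le_anti.
  by rewrite st ts.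
- have [[s0 Fs0]|F0] := pselect (exists s, F s); last first.
    (* The empty chain is bounded by [p] itself. *)
    exists (exist _ p (conj sp (fun x => lexx (p x))) : T) => s Fs.
    by case: F0; exists s.
  pose D x := [set sval s x | s in F].
  have Dinf x : has_inf (D x).
    split; first by exists (sval s0 x); exists s0.
    exists (- p (- x)) => _ [[s [ss sp']] /= _ <-].
    by have := sublinear_opp x ss; have := sp' (- x); lra.
  have Dle s x : F s -> inf (D x) <= sval s x.
    by move=> Fs; apply: ge_inf; [exact: (Dinf x).2|exists s].
  have sD : sublinear (fun x => inf (D x)).
    apply: sublinear_inf => // [x y _ _ [s Fs <-] [t Ft <-]|r x _ r0 [s Fs <-]].
      have [/asboolP st|/asboolP ts] := tot s t Fs Ft.
        exists (sval t (x + y)); first by exists t.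
        by apply: le_trans ((svalP t).1.1 x y) _; rewrite lerD2r.
      exists (sval s (x + y)); first by exists s.
      by apply: le_trans ((svalP s).1.1 x y) _; rewrite lerD2l.
    by exists (sval s (r *: x)); [exists s|exact: (svalP s).1.2].
  have Dp x : inf (D x) <= p x.
    by apply: le_trans (Dle s0 x Fs0) _; exact: (svalP s0).2.
  exists (exist _ (fun x => inf (D x)) (conj sD Dp) : T) => s Fs.
  by apply/asboolP => x; exact: Dle.
move=> [q [sq qp]] qmin; exists q; split=> // q' sq' q'q.
have q'p x : q' x <= p x by exact: le_trans (q'q x) (qp x).
have : le (exist _ q (conj sq qp) : T) (exist _ q' (conj sq' q'p) : T).
  exact/asboolP.
by move/qmin => /(congr1 sval).
Qed.

(* A minimal sublinear functional is linear: it equals all of its tilts. *)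
Lemma hahn_banach p x0 : sublinear p ->
  exists f : V -> R, [/\ scalar f, forall x, f x <= p x & f x0 = p x0].
Proof.
(* Tilting along [x0] first gives [p' (- x0) <= - p x0], so any linear functional below [p'] is at
   least [p x0] at [x0]. *)
move=> sp; have [p' [sp' p'p p'x0]] := sublinear_tilt x0 sp.
have [f [sf fp' fmin]] := sublinear_minimal sp'.
have fD x y : f (x + y) = f x + f y.
  apply/le_anti; rewrite sf.1 /=; have [q [sq qf qy]] := sublinear_tilt y sf.
  by have := qy x; rewrite (fmin _ sq qf); lra.
have fN x : f (- x) = - f x.
  by have := fD x (- x); rewrite subrr sublinear0//; lra.
exists f; split=> [r x y|x|].
- rewrite fD; congr (_ + _); have [r0|r0|->] := ltgtP r 0.
  + by rewrite -[LHS]opprK -fN -scaleNr sublinearZ ?oppr_gt0// mulNr opprK.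
  + exact: sublinearZ.
  + by rewrite scale0r sublinear0// mul0r.
- exact: le_trans (fp' x) (p'p x).
- apply/le_anti/andP; split; first exact: le_trans (fp' _) (p'p _).
  have := fp' (- x0); have := p'x0 (- x0).
  by rewrite addNr (sublinear0 sp) fN; lra.
Qed.

End HahnBanach.

(** * States *)

Section States.
Variables (R : realType) (A : cstarAlgType R).
Local Notation B := (realified A).
Local Notation one := (1 : B).
Implicit Types (x y : B) (r s : R) (phi : {scalar A}).

Lemma positiveP x : positive (x : A) <-> pos x.
Proof.
split=> [[y ->]|/pos_sqrt[h [hs hh _]]]; first exact: (pos_starM (y : B)).
by exists h; rewrite -{1}hh -{1}hs.
Qed.

Definition re x : B := 2^-1 *: (x + star x).

Lemma re_sa x : star (re x) = re x.
Proof. by rewrite /re starZ starD starK addrC. Qed.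

Lemma sa_re x : star x = x -> re x = x.
Proof. by rewrite /re => ->; rewrite scale_half. Qed.

Lemma reD x y : re (x + y) = re x + re y.
Proof. by rewrite /re starD addrACA scalerDr. Qed.

Lemma reZ r x : re (r *: x) = r *: re x.
Proof. by rewrite /re starZ -scalerDr !scalerA mulrC. Qed.

Lemma re_muli_sa x : star x = x -> re (muli x) = 0.
Proof. by move=> xs; rewrite /re star_muli xs subrr scaler0. Qed.

Lemma re_muliE x : x = re x + muli (re (- muli x)).
Proof.
rewrite /re starN star_muli opprK muliZ muliD muliN !muliK opprK -scalerDr.
by rewrite addrACA subrr addr0 scale_half.
Qed.

Lemma nrm_re x : nrm (re x) <= nrm x.
Proof.
rewrite /re nrmZ ger0_norm ?invr_ge0//.
by have := nrmD x (star x); rewrite nrm_star; lra.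
Qed.

Lemma scalarZ_real phi r x : phi (r *: x) = r%:C%C * phi x.
Proof. exact: linearZ. Qed.

Lemma scalarZ_muli phi x : phi (muli x) = 'i%C * phi x.
Proof. exact: linearZ. Qed.

Lemma state_scalar phi r : is_state phi -> phi (r *: one) = r%:C%C.
Proof. by move=> [_ phi1]; rewrite scalarZ_real phi1 mulr1. Qed.

Lemma state_pos phi x : is_state phi -> pos x -> 0 <= phi x.
Proof. by move=> [phi0 _] /positiveP; exact: phi0. Qed.

(** The state is nonnegative, in particular real, on both [nrm x - x] and [nrm x + x]. *)
Lemma state_sa phi x : is_state phi -> star x = x ->
  phi x = (complex.Re (phi x))%:C%C /\ `|complex.Re (phi x)| <= nrm x.
Proof.
move=> sphi xs.
have := state_pos sphi (pos_scalarB xs (lexx _)).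
have := state_pos sphi (pos_scalarD xs (lexx _)).
rewrite (linearD phi) (linearB phi) state_scalar//.
case: (phi x) => a b; rewrite !lecE /= => /andP[/eqP b0 h1] /andP[_ h2].
split; first by congr Complex; lra.
by rewrite ler_norml; apply/andP; split; lra.
Qed.

(** The 2 comes from bounding the real and imaginary parts of [x] separately. *)
Lemma state_bounded phi x : is_state phi -> `|phi x| <= (2 * nrm x)%:C%C.
Proof.
move=> sphi; have [e1 b1] := state_sa sphi (re_sa x).
have [e2 b2] := state_sa sphi (re_sa (- muli x)).
have real (r : R) : `|r%:C%C| = `|r|%:C%C.
  by have := normc_def r%:C%C; rewrite /= expr0n addr0 sqrtr_sqr.
rewrite {1}[x]re_muliE (linearD phi) (le_trans (ler_normD _ _))//.
rewrite scalarZ_muli normrM.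
have -> : `|'i%C : R[i]| = 1.
  by have := normc_def ('i%C : R[i]); rewrite /= expr0n add0r expr1n sqrtr1.
rewrite mul1r e1 e2 !real -rmorphD lecR.
have := nrm_re x; have := nrm_re (- muli x); rewrite nrmN nrm_muli; lra.
Qed.

Lemma scalar_map (g : A -> R[i]) : scalar g -> exists phi, phi =1 g.
Proof.
move=> lg; pose phi : {scalar A} := HB.pack g (GRing.isLinear.Build _ _ _ _ g lg).
by exists phi.
Qed.

Lemma scale_complex (c : R[i]) x :
  c *: (x : A) = (complex.Re c *: x + complex.Im c *: muli x : B).
Proof.
by rewrite {1}[c]complexE mulrC scalerDl -scalerA.
Qed.

(** [f x - i f (ix)] is the only complex-linear functional with real part [f]. *)
Lemma complexify (f : B -> R) : scalar f ->
  exists phi, forall x, phi x = Complex (f x) (- f (muli x)).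
Proof.
move=> lf; have fD x y : f (x + y) = f x + f y.
  by have := lf 1 x y; rewrite scale1r mul1r.
have f0 : f 0 = 0 by have := fD 0 0; rewrite addr0; lra.
have fZ r x : f (r *: x) = r * f x by have := lf r x 0; rewrite !addr0 f0 addr0.
have fN x : f (- x) = - f x by rewrite -scaleN1r fZ mulN1r.
apply: scalar_map => c x y.
rewrite (scale_complex c (x : B)) -/(muli _).
rewrite !(muliD, fD, muliZ, fZ, muliK, fN); case: c => a b /=.
by apply/eqP; rewrite eq_complex /=; apply/andP; split; apply/eqP; ring.
Qed.

End States.

(** * Ergodic averages *)

Section Averages.
Variables (R : realType) (A : cstarAlgType R) (T : {linear A -> A}).
Local Notation B := (realified A).
Local Notation one := (1 : B).
Implicit Types (x y : B) (r s e : R) (phi : {scalar A}).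

(** At [n = 0] this is 0, which is why facts about the unit and invariant states assume [0 < n]. *)
Definition avg (n : nat) x : B := n%:R^-1 *: (\sum_(0 <= k < n) iter k T x : B).

Lemma linear_muli x : T (muli x) = muli (T x).
Proof. exact: linearZ. Qed.

Lemma iterT_linear n r x y :
  iter n T (r *: x + y) = r *: (iter n T x : B) + iter n T y.
Proof.
elim: n => // n IH; rewrite !iterS IH.
exact: (linearP T r%:C%C (iter n T x)).
Qed.

Lemma iterTB n x y : iter n T (x - y) = (iter n T x : B) - iter n T y.
Proof. by rewrite addrC -[- y]scaleN1r iterT_linear scaleN1r addrC. Qed.

Lemma iterTZ n r x : iter n T (r *: x) = r *: (iter n T x : B).
Proof. by elim: n => // n IH; rewrite !iterS IH; exact: linearZ. Qed.

Lemma avg_linear n r x y : avg n (r *: x + y) = r *: avg n x + avg n y.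
Proof.
rewrite /avg (eq_bigr _ (fun k _ => iterT_linear k r x y)) big_split /=.
by rewrite -scaler_sumr scalerDr !scalerA mulrC.
Qed.

Lemma avgB n x y : avg n (x - y) = avg n x - avg n y.
Proof. by rewrite addrC -scaleN1r avg_linear scaleN1r addrC. Qed.

Lemma avg0 n : avg n 0 = 0.
Proof. by have := avgB n 0 0; rewrite !subrr. Qed.

Lemma avgZ n r x : avg n (r *: x) = r *: avg n x.
Proof. by rewrite -[r *: x]addr0 avg_linear avg0 addr0. Qed.

Lemma avgD n x y : avg n (x + y) = avg n x + avg n y.
Proof. by rewrite -[x]scale1r avg_linear !scale1r. Qed.

Lemma avgN n x : avg n (- x) = - avg n x.
Proof. by rewrite -sub0r avgB avg0 sub0r. Qed.

Lemma avg_coboundary n x :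
  avg n ((T x : B) - x) = n%:R^-1 *: ((iter n T x : B) - x).
Proof.
rewrite avgB /avg -scalerBr -sumrB; congr (_ *: _).
under eq_bigr do rewrite -iterSr iterS.
rewrite (telescope_sumr (fun k => iter k T x : B))//.
Qed.

Lemma avg_invariant phi n x :
  preserves T phi -> (0 < n)%N -> phi (avg n x) = phi x.
Proof.
move=> Tphi n0; have phik k : phi (iter k T x) = phi x.
  by elim: k => // k IH; rewrite iterS Tphi.
rewrite scalarZ_real (linear_sum phi) (eq_bigr _ (fun k _ => phik k)).
rewrite sumr_const_nat subn0.
have -> : phi x *+ n = n%:R * phi x by rewrite mulr_natl.
by rewrite fmorphV rmorph_nat mulKf// pnatr_eq0 -lt0n.
Qed.

(** * Averages of a Markov operator and their eventual upper bounds *)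

Hypothesis markovT : is_markov T.

Lemma markov_one n : iter n T one = one.
Proof. by elim: n => // n IH; rewrite iterS IH; exact: markovT.2. Qed.

Lemma markov_pos n x : pos x -> pos (iter n T x).
Proof.
by move=> /positiveP px; apply/positiveP; elim: n => // n; exact: markovT.1.
Qed.

Lemma avg_pos n x : pos x -> pos (avg n x).
Proof.
move=> px; apply: posZ; first by rewrite invr_ge0.
apply: (big_ind (fun y : B => pos y)) => [|y z|k _].
- by have := pos_scalar A (lexx (0 : R)); rewrite scale0r.
- exact: posD.
- exact: markov_pos.
Qed.

Lemma avg_one n : (0 < n)%N -> avg n one = one.
Proof.
move=> n0; rewrite /avg (eq_bigr _ (fun k _ => markov_one k)) sumr_const_nat subn0.
have -> : one *+ n = (n%:R : R) *: one by rewrite scaler_nat.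
by rewrite scalerA mulVf ?scale1r// pnatr_eq0 -lt0n.
Qed.

Lemma markov_scalarB n r x :
  iter n T (r *: one - x) = r *: one - iter n T x :> B.
Proof. by rewrite iterTB iterTZ markov_one. Qed.

(** Positive elements have self-adjoint images; apply this to [nrm x - x] and cancel the scalar,
    which is fixed. *)
Lemma markov_sa n x : star x = x -> star (iter n T x : B) = iter n T x.
Proof.
move=> xs; have [+ _] := markov_pos n (pos_scalarB xs (lexx _)).
by rewrite markov_scalarB starD starN sa_scalar => /addrI/oppr_inj.
Qed.

Lemma avg_sa n x : star x = x -> star (avg n x) = avg n x.
Proof.
move=> xs; rewrite /avg starZ; congr (_ *: _).
apply: (big_ind (fun y : B => star y = y)) => [|y z ys zs|k _].
- exact: star0.
- by rewrite starD ys zs.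
- exact: markov_sa.
Qed.

(** Passing to [re x] defines the bound on the whole real space, so Hahn-Banach applies there rather
    than on the self-adjoint part. *)
Definition avg_ubound x r : Prop :=
  exists N, forall n, (N <= n)%N -> pos (r *: one - avg n (re x)).

Lemma avg_ubound_nrm x : avg_ubound x (nrm x).
Proof.
exists 1%N => n n0; rewrite -[X in _ *: X - _](avg_one n0) -avgZ -avgB.
by apply/avg_pos/pos_scalarB; [exact: re_sa|exact: nrm_re].
Qed.

(** An invariant state has the same value on every nonempty average. The system's own state thus
    bounds the upper bounds from below, and their infimum is finite. *)
Lemma avg_ubound_ge phi x r : is_state phi -> preserves T phi ->
  avg_ubound x r -> complex.Re (phi (re x)) <= r.
Proof.
move=> sphi Tphi [N ubN].
have := state_pos sphi (ubN N.+1 (leqnSn N)).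
rewrite (linearB phi) state_scalar// avg_invariant//.
by case: (phi _) => a b; rewrite lecE /= => /andP[_]; lra.
Qed.

Lemma avg_uboundD x y r s :
  avg_ubound x r -> avg_ubound y s -> avg_ubound (x + y) (r + s).
Proof.
move=> [M ubM] [N ubN]; exists (maxn M N) => n; rewrite geq_max => /andP[Mn Nn].
rewrite reD avgD scalerDl opprD addrACA; apply: posD; [exact: ubM|exact: ubN].
Qed.

Lemma avg_uboundZ x r s : 0 <= s -> avg_ubound x r -> avg_ubound (s *: x) (s * r).
Proof.
move=> s0 [N ubN]; exists N => n Nn.
by rewrite reZ avgZ -scalerA -scalerBr; apply: posZ => //; exact: ubN.
Qed.

Lemma re_markov x : re (T x) = T (re x).
Proof.
have sT y : star y = y -> star (T y) = T y by exact: (@markov_sa 1).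
rewrite {1}[x]re_muliE (_ : T _ = (T (re x) : B) + muli (T (re (- muli x)))).
  by rewrite reD re_muli_sa ?sT ?re_sa// addr0 sa_re// sT// re_sa.
by rewrite (linearD T) linear_muli.
Qed.

Lemma avg_ubound_coboundary x e : 0 < e -> avg_ubound ((T x : B) - x) e.
Proof.
move=> e0; have x0 : 0 <= 2 * nrm x / e.
  by rewrite divr_ge0 ?mulr_ge0 ?nrm_ge0// ltW.
(* The average telescopes to [(T^n h - h) / n], which is at most [2 * nrm x / n]; the successor
   keeps [n] positive. *)
exists (Num.bound (2 * nrm x / e)).+1 => n nN.
have n0 : (0 < n)%N by exact: leq_trans nN.
have nx : 2 * nrm x <= n%:R * e.
  rewrite -ler_pdivrMr// (le_trans (ltW (archi_boundP x0)))// ler_nat.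
  exact: leq_trans nN.
have -> : re ((T x : B) - x) = (T (re x) : B) - re x.
  by rewrite -re_markov -scaleN1r addrC reD reZ scaleN1r addrC.
rewrite avg_coboundary; set h := re x.
have -> : e *: one = n%:R^-1 *: ((n%:R * e) *: one).
  by rewrite scalerA mulrA mulVf ?mul1r// pnatr_eq0 -lt0n.
rewrite -scalerBr; apply: posZ; first by rewrite invr_ge0.
apply: (@pos_scalar_sub _ _ (nrm h + nrm h)).
  by have := nrm_re x; rewrite -/h; lra.
have -> : (nrm h + nrm h) *: one - ((iter n T h : B) - h) =
    (iter n T (nrm h *: one - h) : B) + (nrm h *: one + h).
  by rewrite markov_scalarB scalerDl opprB !addrA [LHS](ACl (1*4*2*3)).
by apply: posD; [apply/markov_pos/pos_scalarB|apply: pos_scalarD]; rewrite ?re_sa.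
Qed.

Lemma avg_ubound_neg x : pos x -> avg_ubound (- x) 0.
Proof.
move=> px; exists 0%N => n _.
rewrite -[- x]scaleN1r reZ avgZ scale0r sub0r scaleN1r opprK sa_re ?px.1//.
exact: avg_pos.
Qed.

(** With [r] of either sign, a dominated linear functional must vanish on i times self-adjoint
    elements. *)
Lemma avg_ubound_skew x r : star x = x -> avg_ubound (r *: muli x) 0.
Proof.
move=> xs; exists 0%N => n _.
rewrite reZ re_muli_sa// scaler0 avg0 subr0.
exact: pos_scalar.
Qed.

Lemma avg_ubound_scalar r : avg_ubound (r *: one) r.
Proof.
exists 1%N => n n0; rewrite sa_re ?sa_scalar// avgZ avg_one// subrr.
by have := pos_scalar A (lexx (0 : R)); rewrite scale0r.
Qed.

(** * The limit superior of the averages and invariant states *)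

Variable phi : {scalar A}.
Hypotheses (sphi : is_state phi) (Tphi : preserves T phi).

Definition avg_limsup x : R := inf [set r | avg_ubound x r].

Lemma avg_ubound_inf x : has_inf [set r | avg_ubound x r].
Proof.
split; first by exists (nrm x); exact: avg_ubound_nrm.
by exists (complex.Re (phi (re x))) => r; exact: avg_ubound_ge.
Qed.

Lemma avg_limsup_le x r : avg_ubound x r -> avg_limsup x <= r.
Proof. by move=> ubr; apply: ge_inf => //; exact: (avg_ubound_inf x).2. Qed.

Lemma avg_limsup_lt x r : avg_limsup x < r -> avg_ubound x r.
Proof.
move=> lt; have [s [N ubN] sr] := inf_lt (avg_ubound_inf x).1 lt.
by exists N => n Nn; apply: pos_scalar_sub (ltW sr) _; exact: ubN.
Qed.

Lemma avg_limsup_sublinear : sublinear avg_limsup.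
Proof.
apply: sublinear_inf => [x|x y a b ua ub|r x a r0 ua].
- exact: avg_ubound_inf.
- by exists (a + b) => //; exact: avg_uboundD.
- by exists (r * a) => //; apply: avg_uboundZ => //; exact: ltW.
Qed.

Lemma invariant_state_exists x : star x = x ->
  exists psi : {scalar A}, [/\ is_state psi, preserves T psi
    & complex.Re (psi x) = avg_limsup x].
Proof.
move=> xs; have [f [lf fle fx]] := hahn_banach x avg_limsup_sublinear.
have fub y r : avg_ubound y r -> f y <= r.
  by move=> /avg_limsup_le; exact: le_trans.
have fD y z : f (y + z) = f y + f z.
  by have := lf 1 y z; rewrite scale1r mul1r.
have f0 : f 0 = 0 by have := fD 0 0; rewrite addr0; lra.
have fZ r y : f (r *: y) = r * f y by have := lf r y 0; rewrite !addr0 f0 addr0.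
have fN y : f (- y) = - f y by rewrite -scaleN1r fZ mulN1r.
(* Consequently the complexification of [f] agrees with [f] on self-adjoint elements. *)
have fskew y : star y = y -> f (muli y) = 0.
  move=> ys; have := fub _ _ (avg_ubound_skew 1 ys).
  by have := fub _ _ (avg_ubound_skew (-1) ys); rewrite !fZ; lra.
have fT y : f (T y) = f y.
  (* Coboundaries give one inequality; using it at [- y] gives the other. *)
  have le z : f (T z) - f z <= 0.
    apply/ler_addgt0Pr => e e0; rewrite add0r -fN -fD.
    exact/fub/avg_ubound_coboundary.
  have := le y; have := le (- y); rewrite (_ : T (- y) = - (T y : B)) ?fN; first lra.
  exact: (linearN T).
have f1 : f one = 1.
  have := fub _ _ (avg_ubound_scalar 1); have := fub _ _ (avg_ubound_scalar (-1)).
  by rewrite !fZ; lra.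
have [psi psiE] := complexify lf.
exists psi; split.
- split=> [y /positiveP py|]; last by rewrite psiE fskew ?star1// f1 oppr0.
  rewrite psiE fskew ?py.1// oppr0 lecE /= eqxx /=.
  by have := fub _ _ (avg_ubound_neg py); rewrite fN; lra.
- move=> y; rewrite !psiE fT; congr Complex; rewrite -[in RHS]fT.
  by congr (- f _); rewrite linear_muli.
- by rewrite psiE.
Qed.

End Averages.

(** * Convergence of the averages and the equivalence *)

Section Convergence.
Variables (R : realType) (A : cstarAlgType R).
Local Notation B := (realified A).
Local Notation one := (1 : B).

(** A positive tolerance in [R[i]] is a positive real, so real tolerances suffice. *)
Lemma convergesP (u : nat -> A) (l : A) :
  converges (u : nat -> B) (l : B) <-> u n @[n --> \oo] --> l.
Proof.
have nE n : `|l - u n| = (nrm ((u n : B) - l))%:C%C.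
  by rewrite nrm_dist -nrmE.
split=> [ul|/cvgrPdist_le ul e e0].
  apply/cvgrPdist_le => e e0.
  have re0 : 0 < complex.Re e by move: e0; rewrite ltcE /= => /andP[].
  have ee : e = (complex.Re e)%:C%C by rewrite RRe_real// gtr0_real.
  have [N uN] := ul _ re0; exists N => // n /= Nn.
  by rewrite nE ee lecR uN.
have [|N _ uN] := ul e%:C%C; first by rewrite ltcR.
by exists N => n Nn; have := uN n Nn; rewrite /= nE lecR.
Qed.

Lemma avgE (T : {linear A -> A}) n (x : A) :
  n%:R^-1 *: (\sum_(0 <= k < n) iter k T x) = avg T n x :> A.
Proof. by rewrite /avg scale_realified fmorphV rmorph_nat. Qed.

Lemma scalar_avg (T : {linear A -> A}) (psi : {scalar A}) n (x : A) :
  n%:R^-1 * (\sum_(0 <= k < n) psi (iter k T x)) = psi (avg T n x).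
Proof. by rewrite -avgE linearZ linear_sum. Qed.

Lemma avg_muli (T : {linear A -> A}) n (x : B) :
  avg T n (muli x) = muli (avg T n x).
Proof.
have iterT k : iter k T (muli x) = muli (iter k T x).
  by elim: k => // k IH; rewrite !iterS IH linear_muli.
rewrite /avg muliZ (eq_bigr _ (fun k _ => iterT k)); congr (_ *: _).
by rewrite (big_morph (@muli R A) (@muliD R A) (id1 := 0)) ?/muli ?scaler0.
Qed.

Lemma strictly_ergodic_converges_sa (phi : {scalar A}) (T : {linear A -> A})
    (x : B) :
  is_markov T -> strictly_ergodic phi T -> star x = x ->
  converges (fun n => avg T n x) (complex.Re (phi x) *: one).
Proof.
move=> mT [sphi Tphi uniq].
have ub (y : B) e : star y = y -> 0 < e ->
    avg_ubound T y (complex.Re (phi y) + e).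
  move=> ys e0; apply: (avg_limsup_lt mT sphi Tphi).
  (* The limit superior at [y] is attained by an invariant state, which uniqueness identifies with
     [phi]. *)
  have [psi [spsi Tpsi <-]] := invariant_state_exists mT sphi Tphi ys.
  by rewrite (uniq psi)// ltrDl.
move=> xs e e0.
(* The third offsets the factor 3 of [nrm_le_order]; bounds at [x] and [- x] give the two order
   inequalities. *)
have e3 : 0 < e / 3 by rewrite divr_gt0.
have [M ubM] := ub x _ xs e3; have [|N ubN] := ub (- x) _ _ e3.
  by rewrite starN xs.
exists (maxn M N) => n; rewrite geq_max => /andP[/ubM Mn /ubN Nn].
have -> : e = 3 * (e / 3) by field.
have as_ : star (avg T n x) = avg T n x by exact: avg_sa.
apply: nrm_le_order; last exact: ltW.
- by rewrite starD starN sa_scalar as_.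
- move: Nn; rewrite sa_re ?starN ?xs// avgN opprK (linearN phi) raddfN scalerDl.
  by rewrite scaleNr -addrA [- _ + _]addrC addrCA addrA [X in X + _]addrC.
- move: Mn; rewrite sa_re// scalerDl opprB addrA.
  by rewrite [X in X - _]addrC.
Qed.

End Convergence.

Unset Implicit Arguments.

Theorem theorem3p2 (R : realType) (A : cstarAlgType R)
    (phi : {scalar A}) (T : {linear A -> A})
    (sys : state_preserving_system phi T) :
  [<-> (* (i) *)
       strictly_ergodic phi T;
       (* (ii) *)
       forall x : A,
         n%:R^-1 *: (\sum_(0 <= k < n) iter k T x) @[n --> \oo]
           --> phi x *: (cunit : A);
       (* (iii) *)
       forall (x : A) (psi : {scalar A}), is_state psi ->
         (n%:R^-1 * (\sum_(0 <= k < n) psi (iter k T x)) : R[i]^o)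
           @[n --> \oo] --> (phi x : R[i]^o)].
Proof.
have [sphi mT Tphi] := sys.
tfae.
- move=> erg x.
  under eq_fun do rewrite avgE.
  apply/convergesP => e e0; have e2 : 0 < e / 2 by rewrite divr_gt0.
  have conv := strictly_ergodic_converges_sa mT erg.
  have [M cM] := conv _ (re_sa (x : realified A)) _ e2.
  have [N cN] := conv _ (re_sa (- muli (x : realified A))) _ e2.
  exists (maxn M N) => n; rewrite geq_max => /andP[/cM Mn /cN Nn].
  (* The real and imaginary parts of [x] each contribute an error of at most [e / 2]. *)
  rewrite [x in avg _ _ x](re_muliE x) avgD avg_muli.
  set h := re _ in Mn *; set k := re _ in Nn *.
  have -> : phi x *: (cunit : A) = (complex.Re (phi h) *: (1 : realified A) +
      muli (complex.Re (phi k) *: (1 : realified A)) : realified A).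
    rewrite {1}[x](re_muliE x) (linearD phi) scalarZ_muli -/h -/k.
    have [-> _] := state_sa sphi (re_sa (x : realified A)).
    have [-> _] := state_sa sphi (re_sa (- muli (x : realified A))).
    by rewrite scalerDl -scalerA.
  rewrite opprD addrACA -muliN -muliD (le_trans (nrmD _ _))// nrm_muli.
  by rewrite [leRHS]splitr lerD.
- move=> cvx x psi spsi.
  under eq_fun do rewrite scalar_avg.
  have /(_ x) := cvx; under eq_fun do rewrite avgE.
  move=> /convergesP cx; apply/cvgrPdist_le => e e0.
  have re0 : 0 < complex.Re e by move: e0; rewrite ltcE /= => /andP[].
  have ee : e = (complex.Re e)%:C%C by rewrite RRe_real// gtr0_real.
  (* Half the tolerance absorbs the constant 2 of [state_bounded]. *)
  have e2 : 0 < complex.Re e / 2 by rewrite divr_gt0.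
  have [N cN] := cx _ e2; exists N => // n /= /cN Nn.
  have -> : phi x - psi (avg T n x) =
      psi ((phi x *: (cunit : A) : realified A) - avg T n x).
    rewrite (linearB psi); congr (_ - _).
    by rewrite linearZ spsi.2 /= mulr1.
  apply: le_trans (state_bounded _ spsi) _.
  by rewrite ee lecR nrm_dist -ler_pdivlMl// mulrC.
- move=> cvpsi; split=> // psi spsi Tpsi x.
  have c1 := cvpsi x psi spsi.
  have c2 : (n%:R^-1 * (\sum_(0 <= k < n) psi (iter k T x)) : R[i]^o)
      @[n --> \oo] --> (psi x : R[i]^o).
    (* For an invariant [psi] the averages equal [psi x] from [n = 1] on; uniqueness of limits then
       gives [psi x = phi x]. *)
    apply: cvg_near_cst; exists 1%N => // n /= n0.
    by rewrite scalar_avg avg_invariant.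
  exact: (cvg_unique _ c2 c1).
Qed.
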